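(* The sequence $\bigl(A_n(x,h\,|\,p,q)\bigr)_{n\ge0}$ is coefficientwise-Hankel totally positive in the variables $\{x,h,p,q\}$.
   Context: $\mathfrak{S}_N$ is the set of permutations $\sigma=\sigma_1\cdots\sigma_N$ of $[N]$. With the convention $\sigma_0=\sigma_{N+1}=0$, a letter $\sigma_i$ ($i\in[N]$) is a valley if $\sigma_{i-1}>\sigma_i<\sigma_{i+1}$ and a peak if $\sigma_{i-1}<\sigma_i>\sigma_{i+1}$; $\mathrm{Val}(\sigma)$, $\mathrm{Pk}(\sigma)$ are the sets of letters that are valleys, peaks. $\mathrm{des}(\sigma)=\#\{1\le i\le N-1:\sigma_i>\sigma_{i+1}\}$. For $\sigma\in\mathfrak{S}_N$, $\mathrm{D}(\sigma)=\sum_{i\in\mathrm{Pk}(\sigma)\setminus\{N\}}i-\sum_{j\in\mathrm{Val}(\sigma)}j$. $(31\!-\!2)(\sigma)$ is the number of pairs $i<j\le N$ with $\sigma_i>\sigma_j>\sigma_{i+1}$; $(2\!-\!13)(\sigma)$ is the number of pairs $i<j<N$ with $\sigma_j<\sigma_i<\sigma_{j+1}$. Define $$A_n(x,h\,|\,p,q)=\sum_{\sigma\in\mathfrak{S}_{n+1}}x^{\mathrm{des}(\sigma)}h^{\mathrm{D}(\sigma)}p^{(31-2)(\sigma)}q^{(2-13)(\sigma)}.$$ A sequence $(a_n)_{n\ge0}$ of real polynomials in a set of variables $\mathbf{X}$ is coefficientwise-Hankel totally positive in $\mathbf{X}$ if every minor of the infinite Hankel matrix $(a_{i+j})_{i,j\ge0}$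 is a polynomial in $\mathbf{X}$ with nonnegative coefficients. *)

(* Defs.v *)
From mathcomp Require Import all_boot all_order all_fingroup all_algebra.
From mathcomp Require Import ring lra zify.
From mathcomp.multinomials Require Import mpoly.

Set Implicit Arguments.
Unset Strict Implicit.
Unset Printing Implicit Defensive.

Import Order.TTheory GRing.Theory Num.Theory.

Section PermutationStatistics.

Variables (N : nat) (s : 'S_N).

(* ['S_N] permutes {0, .., N-1}; the letters of the word are shifted by one,
   so that they range over {1, .., N}. *)
Definition word : seq nat := [seq (s k).+1 | k <- enum 'I_N].

(* sigma_i for 1 <= i <= N, and sigma_0 = sigma_{N+1} = 0 (the latter by the
   default value of [nth]). *)
Definition letter (i : nat) : nat := nth 0 (0 :: word) i.

Definition is_valley (i : nat) : bool :=
  (letter i.-1 > letter i) && (letter i < letter i.+1).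

Definition is_peak (i : nat) : bool :=
  (letter i.-1 < letter i) && (letter i > letter i.+1).

(* Sets of letters, as duplicate-free sequences (the letters of a permutation
   are pairwise distinct). *)
Definition Val : seq nat := [seq letter i | i <- iota 1 N & is_valley i].

Definition Pk : seq nat := [seq letter i | i <- iota 1 N & is_peak i].

Definition des : nat :=
  #|[set i : 'I_N | (1 <= i) && (letter i > letter i.+1)]|.

Definition D : int :=
  (\sum_(i <- Pk | i != N) i%:Z - \sum_(j <- Val) j%:Z)%R.

(* The positions i, j range over 'I_N.+1 = {0, .., N}. *)
Definition pat31_2 : nat :=
  #|[set ij : 'I_N.+1 * 'I_N.+1 |
      [&& 1 <= ij.1, ij.1 < ij.2,
          letter ij.1 > letter ij.2 & letter ij.2 > letter ij.1.+1]]|.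

Definition pat2_13 : nat :=
  #|[set ij : 'I_N.+1 * 'I_N.+1 |
      [&& 1 <= ij.1, ij.1 < ij.2, ij.2 < N,
          letter ij.2 < letter ij.1 & letter ij.1 < letter ij.2.+1]]|.

Lemma size_word : size word = N.
Proof. by rewrite size_map size_enum_ord. Qed.

Lemma uniq_word : uniq word.
Proof.
rewrite map_inj_uniq ?enum_uniq// => a b [] /val_inj; exact: perm_inj.
Qed.

Lemma letter_last : letter N.+1 = 0.
Proof. by rewrite /letter /= nth_default// size_word. Qed.

Lemma letter_inj i j :
  1 <= i <= N -> 1 <= j <= N -> letter i = letter j -> i = j.
Proof.
case: i j => [|i] [|j] //= hi hj /eqP.
by rewrite /letter /= nth_uniq ?size_word ?uniq_word// => /eqP ->.
Qed.

Lemma letter_gt0 i : 1 <= i <= N -> 0 < letter i.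
Proof.
case: i => [|i] //= hi; rewrite /letter /=.
have /mapP[k _ ->//] : nth 0 word i \in word by rewrite mem_nth ?size_word.
Qed.

Lemma letter_neqS i : 0 < N -> i <= N -> letter i != letter i.+1.
Proof.
move=> N0 iN; apply/eqP => e.
case: (posnP i) e => [->|i0] e.
  by have := @letter_gt0 1 N0; rewrite -e.
move: iN; rewrite leq_eqVlt => /orP[/eqP iN|iN].
  by have := @letter_gt0 i; rewrite e iN letter_last => /(_ _)/=;
     rewrite -iN i0 leqnn => /(_ isT).
have := @letter_inj i i.+1; rewrite i0 iN ltnW// => /(_ isT isT e) /eqP.
by rewrite ltn_eqF.
Qed.

Lemma letter_surj : 0 < N -> exists2 i, 1 <= i <= N & letter i = N.
Proof.
move=> N0.
have hN : N.-1 < N by rewrite prednK.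
have hw : N \in word.
  apply/mapP; exists ((s^-1)%g (Ordinal hN)); rewrite ?mem_enum//.
  by rewrite permKV /= prednK.
exists (index N word).+1; last by rewrite /letter /= nth_index.
by rewrite /= -[X in _ < X]size_word index_mem.
Qed.

Local Open Scope ring_scope.

(* D plus the letter N is the sum of sigma_i - sigma_{i-1} over all ascents,
   which is at least max_i sigma_i = N. *)
Let S m : int := \sum_(i <- iota 1 m | is_peak i) (letter i)%:Z
  - \sum_(i <- iota 1 m | is_valley i) (letter i)%:Z.

Let T m : int := S m + (letter m)%:Z *+ (letter m < letter m.+1)%N.

Let T_rec m : (m < N)%N ->
  T m.+1 =
    T m + ((letter m.+1)%:Z - (letter m)%:Z) *+ (letter m < letter m.+1)%N.
Proof.
move=> mN; have N0 : (0 < N)%N by exact: leq_ltn_trans mN.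
rewrite /T /S -[in iota 1 m.+1](addn1 m) iotaD !big_cat /= !big_cons !big_nil.
rewrite add1n /is_peak /is_valley /=.
have n1 := letter_neqS N0 (ltnW mN); have n2 := letter_neqS N0 mN.
move: n1 n2.
by case: (ltngtP (letter m) (letter m.+1)) => // _ _ n2;
  case: (ltngtP (letter m.+1) (letter m.+2)) n2 => // _ _ /=;
  rewrite ?mulr1n ?mulr0n; ring.
Qed.

Let T_ge m : (m <= N)%N ->
  0 <= T m /\ forall j, (j <= m)%N -> (letter j)%:Z <= T m.
Proof.
elim: m => [_|m IH mN].
  have T0 : T 0 = 0 by rewrite /T /S !big_nil /= mul0rn; ring.
  by rewrite T0; split=> // j; rewrite leqn0 => /eqP ->.
have [T0 Tj] := IH (ltnW mN); rewrite (T_rec mN).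
have Tm := Tj m (leqnn m).
have e : 0 <= ((letter m.+1)%:Z - (letter m)%:Z) *+ (letter m < letter m.+1)%N.
  by case: ltnP => ? //=; rewrite ?mulr1n; lia.
split; first by rewrite addr_ge0.
move=> j; rewrite leq_eqVlt => /orP[/eqP ->|jm].
  by case: ltnP => ? /=; rewrite ?mulr1n ?mulr0n; lia.
by apply: le_trans (Tj j jm) _; rewrite lerDl.
Qed.

Lemma uniq_Pk : uniq Pk.
Proof.
rewrite map_inj_in_uniq ?filter_uniq ?iota_uniq// => i j.
rewrite !mem_filter !mem_iota !add1n !ltnS => /andP[_ hi] /andP[_ hj].
exact: letter_inj.
Qed.

Lemma uniq_Val : uniq Val.
Proof.
rewrite map_inj_in_uniq ?filter_uniq ?iota_uniq// => i j.
rewrite !mem_filter !mem_iota !add1n !ltnS => /andP[_ hi] /andP[_ hj].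
exact: letter_inj.
Qed.

Lemma D_ge0 : 0 <= D.
Proof.
have [N0|N0] := posnP N; first by rewrite /D /Pk /Val N0 /= !big_nil.
have [i /andP[i0 iN] li] := letter_surj N0.
have [_ /(_ i iN)] := T_ge (leqnn N); rewrite li /T letter_last /= addr0.
have -> : S N = \sum_(i <- Pk) i%:Z - \sum_(j <- Val) j%:Z.
  by rewrite /S /Pk /Val !big_map !big_filter.
rewrite /D (bigID (pred1 N)) /= => h.
have : \sum_(i <- Pk | i == N) i%:Z <= N%:Z.
  have [NP|NP] := boolP (N \in Pk).
    by rewrite -big_filter (filter_pred1_uniq uniq_Pk NP) big_seq1.
  rewrite big_seq_cond big1 // => j /andP[jP /eqP jN].
  by rewrite -jN jP in NP.
lra.
Qed.

End PermutationStatistics.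

Local Open Scope ring_scope.

(* A_n(x, h | p, q) with the indeterminates interpreted in a commutative ring;
   the absolute value only turns the exponent D, nonnegative by [D_ge0], into a
   natural number. *)
Definition A (V : comNzRingType) (x h p q : V) (n : nat) : V :=
  \sum_(s : 'S_n.+1)
    x ^+ des s * h ^+ `|D s|%N * p ^+ pat31_2 s * q ^+ pat2_13 s.

(* A minor of the infinite matrix M is given by strictly increasing sequences
   I and J of k row and k column indices. *)
Definition increasing k (I : 'I_k -> nat) : Prop :=
  forall i j : 'I_k, (i < j)%N -> (I i < I j)%N.

Definition minor (V : comNzRingType) (M : nat -> nat -> V)
    k (I J : 'I_k -> nat) : V :=
  \det (\matrix_(i < k, j < k) M (I i) (J j)).

Definition hankel (V : Type) (a : nat -> V) (i j : nat) : V := a (i + j)%N.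

Definition coef_nonneg d (R : realFieldType) (P : {mpoly R[d]}) : Prop :=
  forall m : 'X_{1..d}, 0 <= P@_m.

Definition coefficientwise_Hankel_TP d (R : realFieldType)
    (a : nat -> {mpoly R[d]}) : Prop :=
  forall k (I J : 'I_k -> nat), increasing I -> increasing J ->
    coef_nonneg (minor (hankel a) I J).

(* Main.v *)
From HB Require Import structures.
Require Import Defs.
From mathcomp Require Import all_boot all_order all_fingroup all_algebra.
From mathcomp Require Import ring zify.
From mathcomp.multinomials Require Import mpoly.

(** The theorem holds because [A_n] is the corner entry of the [n]-th power of a
totally positive tridiagonal matrix.

Combinatorics.  Fix a permutation word of [1, .., N] with [N = n + 1], and write
its letters in the order 1, 2, .., [N]: before [k] is written, the letters [< k]
are in place, and every maximal run of letters [>= k] is a slot still to be filled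
([contract]).  Writing [k] means choosing a slot and deciding whether a slot
remains on the left of [k] and whether one remains on its right.  All four
statistics can be read off these choices: [k] plays the role of the 2 in one
31-2 pattern for each slot to the left of the chosen one and in one 2-13 pattern
for each slot to the right; the letter preceding [k] is larger than [k] exactly
when a slot remains on the left of [k]; and, by summation by parts, [D] is the sum
over [k < N] of the number of slots after [k] is written, minus one.  Choosing
among [c] slots thus contributes the p,q-integer [c]_{p,q}, and the total weight
of the fillings of [c] slots by [r] letters obeys a recursion [hist] in [r] whose
right-hand side involves [c - 1], [c] and [c + 1] slots.  The proof does not
encode permutations by their choices: [fiber_sum] sums over the permutations with
a given contraction and refines the contraction one letter at a time.

Total positivity.  With heights [l = c - 1], the recursion is the action of a
tridiagonal matrix ([motzkin_mx]) that factors as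
[diag([l + 1]_{p,q}) (1 + x U) (1 + L) diag(h^l)], where [U] and [L] are the
upper and lower shifts.  Each factor is bidiagonal with nonnegative entries,
hence totally positive, and by Cauchy-Binet so is the product [J].  The Hankel
matrix [(J^(i+j))_{00}] is the product of the matrix of first rows of powers of
[J] by the matrix of first columns, both of which are totally positive
([power_rows_TP]); Cauchy-Binet concludes. *)

Set Implicit Arguments.
Unset Strict Implicit.
Unset Printing Implicit Defensive.

Import Order.TTheory GRing.Theory Num.Theory.

Local Open Scope ring_scope.

(** * The Cauchy-Binet formula *)

Section CauchyBinet.

Definition incr k m (g : 'I_k -> 'I_m) : bool :=
  [forall i : 'I_k, forall j : 'I_k, (i < j)%N ==> (g i < g j)%N].

Lemma incrP k m (g : 'I_k -> 'I_m) :
  reflect (increasing (fun i => g i : nat)) (incr g).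
Proof.
apply: (iffP forallP) => [h i j ij|h i].
  by have /forallP/(_ j)/implyP := h i; exact.
by apply/forallP => j; apply/implyP; exact: h.
Qed.

Lemma increasing_inj k (I : 'I_k -> nat) : increasing I -> injective I.
Proof.
move=> Iincr i j eI; apply/val_inj/eqP.
by case: ltngtP => // /Iincr; rewrite eI ltnn.
Qed.

Lemma incr_inj k m (g : 'I_k -> 'I_m) : incr g -> injective g.
Proof. by move=> /incrP/increasing_inj gI i j e; apply: gI; rewrite e. Qed.

Lemma sorted_enum_ord m :
  sorted (fun i j : 'I_m => (i < j)%N) (enum 'I_m).
Proof. by have := iota_ltn_sorted 0 m; rewrite -val_enum_ord sorted_map. Qed.

Lemma incr_sorted k m (g : 'I_k -> 'I_m) :
  incr g -> sorted (fun i j : 'I_m => (i < j)%N) (codom g).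
Proof.
move=> /incrP g_incr; rewrite /codom /image_mem sorted_map.
by apply: sub_sorted (sorted_enum_ord k) => i j; exact: g_incr.
Qed.

(** Sorting the values of an injective map factors it as a permutation followed
by an increasing map; this and [incr_factor_uniq] index the nonzero terms of
the expanded determinant. *)
Lemma incr_factor k m (f : 'I_k -> 'I_m) : injective f ->
  exists g : {ffun 'I_k -> 'I_m}, exists s : 'S_k,
    incr g /\ forall i, f i = g (s i).
Proof.
move=> f_inj; pose L := [seq x <- enum 'I_m | x \in codom f].
have memL x : (x \in L) = (x \in codom f) by rewrite mem_filter mem_enum andbT.
have Lsize : size L = k.
  have := uniq_perm (filter_uniq _ (enum_uniq 'I_m)) _ memL.
  rewrite /codom map_inj_uniq // enum_uniq => /(_ isT)/perm_size ->.
  by rewrite size_map size_enum_ord.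
have idx_lt i : (index (f i) L < k)%N.
  by rewrite -[X in (_ < X)%N]Lsize index_mem memL codom_f.
have s_inj : injective (fun i => Ordinal (idx_lt i)).
  move=> i j [e]; apply: f_inj.
  have nthL l : nth (f i) L (index (f l) L) = f l.
    by rewrite nth_index // memL codom_f.
  by rewrite -[LHS]nthL e nthL.
exists [ffun i : 'I_k => nth (f i) L i], (perm s_inj); split; last first.
  by move=> i; rewrite ffunE permE /= nth_index ?memL ?codom_f.
apply/incrP => i j ij; rewrite !ffunE (set_nth_default (f i)) ?Lsize //.
apply: (@sorted_ltn_nth _ (fun i j : 'I_m => (i < j)%N)) => //.
- by move=> a b c; exact: ltn_trans.
- by apply: sorted_filter; [move=> a b c; exact: ltn_trans|exact: sorted_enum_ord].
- by rewrite inE Lsize.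
- by rewrite inE Lsize.
Qed.

Lemma incr_factor_uniq k m (g g' : {ffun 'I_k -> 'I_m}) (s s' : 'S_k) :
  incr g -> incr g' -> (forall i, g (s i) = g' (s' i)) -> g = g' /\ s = s'.
Proof.
move=> g_incr g'_incr e.
have eg : g = g'.
  have : codom g = codom g'.
    apply: (@irr_sorted_eq _ (fun i j : 'I_m => (i < j)%N)).
    - by move=> a b c; exact: ltn_trans.
    - by move=> a; exact: ltnn.
    - exact: incr_sorted.
    - exact: incr_sorted.
    move=> x; apply/codomP/codomP => -[i ->].
      by exists (s' ((s^-1)%g i)); rewrite -e permKV.
    by exists (s ((s'^-1)%g i)); rewrite e permKV.
  rewrite !codomE => /eq_in_map eg; apply/ffunP => i.
  by apply: eg; rewrite mem_enum.
split=> //; subst g'; apply/permP => i.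
by have := e i; move/(incr_inj g_incr).
Qed.

(** Multilinearity in the rows of the product gives a sum over all maps from
rows to intermediate indices.  An injective one is a permutation followed by an
increasing map, and the sign of the permutation rebuilds the minor of [A]. *)
Lemma Cauchy_Binet (V : comNzRingType) k m (A : 'M[V]_(k, m)) (B : 'M_(m, k)) :
  \det (A *m B) = \sum_(g : {ffun 'I_k -> 'I_m} | incr g)
     \det (colsub g A) * \det (rowsub g B).
Proof.
have expand : \det (A *m B) = \sum_(f : {ffun 'I_k -> 'I_m})
    (\prod_i A i (f i)) * \det (rowsub f B).
  pose AB (s : 'S_k) i j := A i j * B j (s i).
  transitivity (\sum_(f : {ffun 'I_k -> 'I_m}) \sum_(s : 'S_k)
    (-1) ^+ s * \prod_i AB s i (f i)).
    rewrite exchange_big; apply: eq_bigr => /= s _; rewrite -big_distrr /=.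
    congr (_ * _); rewrite -(bigA_distr_bigA (AB s)) /=.
    by apply: eq_bigr => x _; rewrite mxE.
  apply: eq_bigr => f _; rewrite big_distrr; apply: eq_bigr => s _ /=.
  rewrite mulrCA big_split //=; congr (_ * (_ * _)).
  by apply: eq_bigr => x _; rewrite mxE.
(* Non-injective maps contribute nothing: they repeat a row of [B]. *)
rewrite expand (bigID (fun f : {ffun 'I_k -> 'I_m} => injectiveb f)) /=.
rewrite [X in _ + X]big1 ?addr0 => [|f Uf]; last first.
  case/injectivePn: Uf => i1 [i2 Di12 Ef12].
  by rewrite (determinant_alternate Di12) ?mulr0 //= => j; rewrite !mxE Ef12.
pose h (p : {ffun 'I_k -> 'I_m} * 'S_k) := [ffun i => p.1 (p.2 i)].
pose P := [set p : {ffun 'I_k -> 'I_m} * 'S_k | incr p.1].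
transitivity (\sum_(f in h @: P) (\prod_i A i (f i)) * \det (rowsub f B)).
  apply: eq_bigl => f; apply/injectiveP/imsetP => [/incr_factor[g [s [gi fE]]]|].
    by exists (g, s); rewrite ?inE //; apply/ffunP => i; rewrite ffunE.
  move=> [[g s]]; rewrite inE /= => /incr_inj gi -> i j.
  by rewrite !ffunE /= => /gi/perm_inj.
rewrite big_imset /=; last first.
  move=> [g s] [g' s']; rewrite !inE /= => gi g'i /ffunP e.
  suff [-> ->] : g = g' /\ s = s' by [].
  by apply: incr_factor_uniq => // i; have := e i; rewrite !ffunE.
transitivity (\sum_(g : {ffun 'I_k -> 'I_m} | incr g) \sum_(s : 'S_k)
   (\prod_i A i (h (g, s) i)) * \det (rowsub (h (g, s)) B)).
  by rewrite pair_big_dep; apply: eq_bigl => -[g s]; rewrite inE /= andbT.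
apply: eq_bigr => g gi; rewrite big_distrl /=; apply: eq_bigr => s _.
have -> : rowsub (h (g, s)) B = row_perm s (rowsub g B).
  by apply/matrixP => i j; rewrite !mxE ffunE.
rewrite row_permE det_mulmx det_perm mulrCA mulrA; congr (_ * _ * _).
by apply: eq_bigr => i _; rewrite ffunE mxE.
Qed.

End CauchyBinet.

(** * Totally positive matrices and Hankel minors *)

Section TotalPositivity.

Variables (V : comNzRingType) (S : semiringClosed V).

(** Nonnegativity is membership in a subsemiring [S], so that for polynomials it
can be nonnegativity of all the coefficients. *)
Definition TP m n (M : 'M[V]_(m, n)) : Prop :=
  forall k (f : 'I_k -> 'I_m) (g : 'I_k -> 'I_n),
    incr f -> incr g -> \det (mxsub f g M) \in S.

Lemma TP_mul m n l (M : 'M_(m, n)) (N : 'M_(n, l)) :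
  TP M -> TP N -> TP (M *m N).
Proof.
move=> tpM tpN k f g fi gi.
have -> : mxsub f g (M *m N) = rowsub f M *m colsub g N.
  by apply/matrixP => i j; rewrite !mxE; apply: eq_bigr => t _; rewrite !mxE.
rewrite Cauchy_Binet rpred_sum // => t ti; apply: rpredM.
  have -> : colsub t (rowsub f M) = mxsub f t M by apply/matrixP => i j; rewrite !mxE.
  exact: tpM.
have -> : rowsub t (colsub g N) = mxsub t g N by apply/matrixP => i j; rewrite !mxE.
exact: tpN.
Qed.

Lemma TP_tr m n (M : 'M_(m, n)) : TP M -> TP M^T.
Proof.
by move=> tpM k f g fi gi; rewrite -trmx_mxsub det_tr; exact: tpM.
Qed.

Lemma incr_lift k m (f : 'I_k.+1 -> 'I_m) :
  incr f -> incr (fun i => f (lift ord0 i)).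
Proof. by move=> /incrP fi; apply/incrP => i j ij; exact: fi. Qed.

Lemma det_col0 k (M : 'M[V]_k.+1) : (forall i, M (lift ord0 i) ord0 = 0) ->
  \det M = M ord0 ord0 * \det (mxsub (lift ord0) (lift ord0) M).
Proof.
move=> M0; rewrite (expand_det_col _ ord0) big_ord_recl big1 => [|i _]; last first.
  by rewrite M0 mul0r.
rewrite addr0 /cofactor expr0 mul1r; congr (_ * \det _).
by apply/matrixP => i j; rewrite !mxE.
Qed.

Lemma det_row0 k (M : 'M[V]_k.+1) : (forall j, M ord0 (lift ord0 j) = 0) ->
  \det M = M ord0 ord0 * \det (mxsub (lift ord0) (lift ord0) M).
Proof.
move=> M0; rewrite -det_tr det_col0 => [|i]; last by rewrite mxE.
by rewrite mxE -trmx_mxsub det_tr.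
Qed.

(** Every minor is the product of its diagonal entries: with rows [f] and columns
[g], the first column vanishes below the corner if [g 0 <= f 0], and the first
row vanishes to the right of the corner if [f 0 < g 0]. *)
Lemma TP_bidiagonal m n (M : 'M_(m, n)) : (forall i j, M i j \in S) ->
  (forall (i : 'I_m) (j : 'I_n), (j < i)%N || (i.+1 < j)%N -> M i j = 0) -> TP M.
Proof.
move=> MS M0; elim=> [|k IH] f g fi gi; first by rewrite det_mx00 rpred1.
suff -> : \det (mxsub f g M) = M (f ord0) (g ord0) *
    \det (mxsub (fun i => f (lift ord0 i)) (fun i => g (lift ord0 i)) M).
  by rewrite rpredM ?IH ?incr_lift.
have mxsub2 : mxsub (fun i => f (lift ord0 i)) (fun i => g (lift ord0 i)) M =
    mxsub (lift ord0) (lift ord0) (mxsub f g M).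
  by apply/matrixP => i j; rewrite !mxE.
have [gf|fg] := leqP (g ord0) (f ord0).
  rewrite det_col0 => [|i]; first by rewrite mxsub2 mxE.
  rewrite mxE M0 // (leq_ltn_trans gf) //.
  by move/incrP: fi; apply.
rewrite det_row0 => [|i]; first by rewrite mxsub2 mxE.
rewrite mxE M0 // orbC (leq_ltn_trans fg) //.
by move/incrP: gi; apply.
Qed.

(** The rows with exponents [I i > 0] are the rows with exponents [I i - 1] times
[J], so Cauchy-Binet lowers all the exponents by one; a row with exponent [0] is
a unit vector, along which the minor is expanded. *)
Lemma power_rows_TP m (J : 'M_m.+1) : TP J ->
  forall k (I : 'I_k -> nat) (g : 'I_k -> 'I_m.+1), increasing I -> incr g ->
  \det (\matrix_(i < k, j < k) (J ^+ I i) ord0 (g j)) \in S.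
Proof.
move=> tpJ k I g.
have [b] : exists b, forall i, (I i < b)%N.
  by exists (\max_i I i).+1 => i; rewrite ltnS leq_bigmax.
elim: b k I g => [|b IH] k I g Ib Ii gi.
  case: k I g Ib Ii gi => [|k] I g Ib; last by have := Ib ord0.
  by rewrite det_mx00 rpred1.
(* Positive exponents: the induction hypothesis applies to [I' - 1]. *)
have pos k' (I' : 'I_k' -> nat) (g' : 'I_k' -> 'I_m.+1) :
    (forall i, 0 < I' i < b.+1)%N -> increasing I' -> incr g' ->
    \det (\matrix_(i < k', j < k') (J ^+ I' i) ord0 (g' j)) \in S.
  move=> I'b I'i g'i.
  have -> : \matrix_(i < k', j < k') (J ^+ I' i) ord0 (g' j) =
      (\matrix_(i < k', l < m.+1) (J ^+ (I' i).-1) ord0 l) *m colsub g' J.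
    apply/matrixP => i j; rewrite !mxE.
    have /andP[I'0 _] := I'b i.
    by rewrite -[in LHS](prednK I'0) exprSr !mxE; apply: eq_bigr => l _; rewrite !mxE.
  rewrite Cauchy_Binet rpred_sum // => t ti; apply: rpredM.
    have -> : colsub t (\matrix_(i < k', l < m.+1) (J ^+ (I' i).-1) ord0 l) =
        \matrix_(i < k', j < k') (J ^+ (I' i).-1) ord0 (t j).
      by apply/matrixP => i j; rewrite !mxE.
    apply: IH => // [i|i j ij]; first by have := I'b i; lia.
    by have := I'i i j ij; have := I'b i; have := I'b j; lia.
  have -> : rowsub t (colsub g' J) = mxsub t g' J.
    by apply/matrixP => i j; rewrite !mxE.
  exact: tpJ.
case: k I g Ib Ii gi => [|k] I g Ib Ii gi; first by rewrite det_mx00 rpred1.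
have I_gt j : (I ord0 < I (lift ord0 j))%N by exact: Ii.
case: (posnP (I ord0)) => I0; last first.
  apply: pos => // i; rewrite Ib andbT.
  by case: (unliftP ord0 i) => [j|] ->; rewrite // (leq_trans I0) ?(ltnW (I_gt j)).
rewrite det_row0 => [|j]; last first.
  rewrite !mxE I0 expr0 !mxE -val_eqE /=.
  have : (g ord0 < g (lift ord0 j))%N by move/incrP: gi; apply.
  by case: (nat_of_ord (g (lift ord0 j))).
have -> : mxsub (lift ord0) (lift ord0)
    (\matrix_(i < k.+1, j < k.+1) (J ^+ I i) ord0 (g j)) =
    \matrix_(i < k, j < k) (J ^+ I (lift ord0 i)) ord0 (g (lift ord0 j)).
  by apply/matrixP => i j; rewrite !mxE.
rewrite rpredM //; first by rewrite mxE I0 expr0 mxE; case: eqP; rewrite ?rpred0 ?rpred1.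
apply: pos => [i|i j ij|]; last exact: incr_lift.
  by rewrite Ib andbT -I0.
exact: Ii.
Qed.

Lemma trmxX m (J : 'M[V]_m.+1) n : (J ^+ n)^T = J^T ^+ n.
Proof.
elim: n => [|n IH]; first by rewrite !expr0 trmx1.
by rewrite exprSr exprS -IH; exact: trmx_mul.
Qed.

(** Since [J^(a+b) = J^a J^b], the matrix is the product of a matrix of first rows
of powers of [J] by a matrix of first columns, and Cauchy-Binet applies. *)
Lemma hankel_corner_minor m (J : 'M_m.+1) : TP J ->
  forall k (I I' : 'I_k -> nat), increasing I -> increasing I' ->
  \det (\matrix_(i < k, j < k) (J ^+ (I i + I' j)) ord0 ord0) \in S.
Proof.
move=> tpJ k I I' Ii I'i.
have -> : \matrix_(i < k, j < k) (J ^+ (I i + I' j)) ord0 ord0 =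
    (\matrix_(i < k, l < m.+1) (J ^+ I i) ord0 l) *m
    (\matrix_(l < m.+1, j < k) (J ^+ I' j) l ord0).
  apply/matrixP => i j; rewrite !mxE exprD !mxE.
  by apply: eq_bigr => l _; rewrite !mxE.
rewrite Cauchy_Binet rpred_sum // => t ti; apply: rpredM.
  have := power_rows_TP tpJ Ii ti; congr (\det _ \in S).
  by apply/matrixP => i j; rewrite !mxE.
rewrite -det_tr; have := power_rows_TP (TP_tr tpJ) I'i ti; congr (\det _ \in S).
by apply/matrixP => i j; rewrite !mxE -trmxX mxE.
Qed.

End TotalPositivity.

(** * Laguerre histories and a tridiagonal matrix *)

Section Histories.

Variables (V : comNzRingType) (x h p q : V).

(** The p,q-integer [c]_{p,q}, the sum of the [p^i q^(c-1-i)] for [i < c]. *)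
Fixpoint pq_nat c : V := if c is c'.+1 then q ^+ c' + p * pq_nat c' else 0.

(** Total weight of the ways to fill [c] slots with [r] letters, written in
increasing order.  The three terms are the cases where the first letter closes its
slot, leaves a slot on one side, or leaves a slot on both sides; the exponent of
[h] is the number of slots after it is written, minus one. *)
Fixpoint hist r c : V :=
  if r is r'.+1 then
    pq_nat c * (h ^+ c.-2 * hist r' c.-1 + (1 + x) * h ^+ c.-1 * hist r' c
                + x * h ^+ c * hist r' c.+1)
  else (c == 0)%:R.

Definition bracket_mx m : 'M[V]_m.+1 := diag_mx (\row_i pq_nat i.+1).
Definition up_mx m : 'M[V]_m.+1 :=
  \matrix_(i, j) ((i == j :> nat)%:R + x * (i.+1 == j :> nat)%:R).
Definition down_mx m : 'M[V]_m.+1 :=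
  \matrix_(i, j) ((i == j :> nat)%:R + (i == j.+1 :> nat)%:R).
Definition height_mx m : 'M[V]_m.+1 := diag_mx (\row_i h ^+ i).

(** Except in its last row, this is the tridiagonal matrix whose entries in row [i]
are [h^(i-1)], [(1+x) h^i] and [x h^(i+1)], all multiplied by the p,q-integer
[i+1]_{p,q}.  Writing it as a product makes its total positivity evident. *)
Definition motzkin_mx m : 'M[V]_m.+1 :=
  bracket_mx m *m (up_mx m *m (down_mx m *m height_mx m)).

Lemma pq_nat_closed (S : semiringClosed V) c : p \in S -> q \in S -> pq_nat c \in S.
Proof.
by move=> pS qS; elim: c => [|c IH] /=; rewrite ?rpred0 // rpredD ?rpredX ?rpredM.
Qed.

Lemma motzkin_TP (S : semiringClosed V) m :
  x \in S -> h \in S -> p \in S -> q \in S -> TP S (motzkin_mx m).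
Proof.
move=> xS hS pS qS.
have diagTP (d : 'rV_m.+1) : (forall i, d ord0 i \in S) -> TP S (diag_mx d).
  move=> dS; apply: TP_bidiagonal => i j; rewrite mxE.
    by rewrite rpredMn.
  by move=> ij; case: eqP ij => // ->; lia.
have boolS (b : bool) : b%:R \in S by rewrite rpred_nat.
do !apply: TP_mul.
- by apply: diagTP => i; rewrite mxE pq_nat_closed.
- apply: TP_bidiagonal => i j; rewrite mxE; first by rewrite rpredD ?rpredM.
  move=> ij.
  have -> : (i == j :> nat) = false by lia.
  have -> : (i.+1 == j :> nat) = false by lia.
  by rewrite mulr0 addr0.
- rewrite -[down_mx m]trmxK; apply: TP_tr.
  apply: TP_bidiagonal => i j; rewrite !mxE; first by rewrite rpredD ?rpredM.
  move=> ij.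
  have -> : (j == i :> nat) = false by lia.
  have -> : (j == i.+1 :> nat) = false by lia.
  by rewrite addr0.
- by apply: diagTP => i; rewrite mxE rpredX.
Qed.

Lemma sum_delta m (F : nat -> V) a :
  \sum_(l < m) (a == l :> nat)%:R * F l = (a < m)%N%:R * F a.
Proof.
case: ltnP => [am|ma].
  rewrite (bigD1 (Ordinal am)) //= eqxx big1 ?addr0 // => i /eqP ia.
  case: eqP => [e|]; last by rewrite mul0r.
  by case: ia; apply/val_inj; rewrite /= e.
rewrite mul0r big1 // => i _; case: eqP => [e|]; last by rewrite mul0r.
by have := ltn_ord i; rewrite -e ltnNge ma.
Qed.

(** Computed by applying the factors to a column one after the other.  In the last
row the truncated upper shift has lost its entry, whence the bound on [c]. *)
Lemma motzkin_mx_col m (F : nat -> V) (c : 'I_m.+1) : (c < m)%N ->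
  \sum_(l < m.+1) motzkin_mx m c l * F l =
  pq_nat c.+1 * ((0 < c)%N%:R * (h ^+ c.-1 * F c.-1) +
    (1 + x) * h ^+ c * F c + x * h ^+ c.+1 * F c.+1).
Proof.
move=> cm.
have colE (M : 'M[V]_m.+1) (G : nat -> V) i :
    (M *m \col_l G l) i ord0 = \sum_l M i l * G l.
  by rewrite mxE; apply: eq_bigr => l _; rewrite !mxE.
rewrite -colE /motzkin_mx -!mulmxA.
have -> : height_mx m *m \col_l F l = \col_l (h ^+ l * F l).
  by apply/matrixP => i j; rewrite mul_diag_mx !mxE.
have -> : down_mx m *m (\col_l (h ^+ l * F l)) =
    \col_l (h ^+ l * F l + (0 < l)%N%:R * (h ^+ l.-1 * F l.-1)).
  apply/matrixP => i j; rewrite ord1 (colE _ (fun l => h ^+ l * F l)) [RHS]mxE.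
  under eq_bigr => l _ do rewrite mxE mulrDl.
  rewrite big_split /= (sum_delta _ (fun l => h ^+ l * F l)) ltn_ord mul1r.
  congr (_ + _).
  case: i => [[|i] im] /=; first by rewrite mul0r big1 // => l _; rewrite mul0r.
  under eq_bigr => l _ do rewrite eqSS.
  by rewrite (@sum_delta _ (fun l => h ^+ l * F l)) ltnW.
have -> : up_mx m *m (\col_l (h ^+ l * F l + (0 < l)%N%:R * (h ^+ l.-1 * F l.-1)))
  = \col_l (h ^+ l * F l + (0 < l)%N%:R * (h ^+ l.-1 * F l.-1)
     + x * ((l < m)%N%:R * (h ^+ l.+1 * F l.+1 + h ^+ l * F l))).
  apply/matrixP => i j; rewrite ord1.
  pose G l := h ^+ l * F l + (0 < l)%N%:R * (h ^+ l.-1 * F l.-1).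
  rewrite (colE _ G) [RHS]mxE.
  under eq_bigr => l _ do rewrite mxE mulrDl -mulrA.
  rewrite big_split /= (sum_delta _ G) ltn_ord mul1r; congr (_ + _).
  by rewrite -big_distrr /= (sum_delta _ G) ltnS /G /= mul1r.
by rewrite mul_diag_mx !mxE cm /=; ring.
Qed.

(** Paths of length [r] from height [c] leave from heights at most [c + r - 1], whose
rows are exact when [c + r <= m].  The shift from [r.+1] to [r] accounts for the
largest letter, which can only close the last slot. *)
Lemma hist_motzkin m r c (cm : (c < m.+1)%N) : (c + r <= m)%N ->
  hist r.+1 c.+1 = (motzkin_mx m ^+ r) (Ordinal cm) ord0.
Proof.
elim: r c cm => [|r IH] c cm crm.
  rewrite expr0 mxE -val_eqE /=.
  by case: c {cm crm} => [|c] /=; rewrite ?expr0; ring.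
rewrite exprS mxE.
have -> : \sum_j motzkin_mx m (Ordinal cm) j * (motzkin_mx m ^+ r) j ord0 =
    \sum_(j < m.+1) motzkin_mx m (Ordinal cm) j *
       (if (j + r <= m)%N then hist r.+1 j.+1 else (motzkin_mx m ^+ r) (inord j) ord0).
  apply: eq_bigr => -[j jm] _ /=; congr (_ * _).
  case: ifP => [|_]; first by move/(IH _ jm).
  by congr (_ _ _); apply/val_inj; rewrite /= inordK.
rewrite (@motzkin_mx_col _ (fun j => if (j + r <= m)%N then hist r.+1 j.+1
  else (motzkin_mx m ^+ r) (inord j) ord0)) /=; last by lia.
have -> : (c + r <= m)%N by lia.
have -> : (c.+1 + r <= m)%N by lia.
have -> : (c.-1 + r <= m)%N by lia.
case: c {cm crm} => [|c] /=; rewrite ?expr0; ring.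
Qed.

End Histories.

(** * Contraction of words *)

Section Contraction.

Local Open Scope nat_scope.

Definition lstrip (w : seq nat) : seq nat :=
  if w is a :: w' then if a == 0 then w' else w else [::].

Fixpoint rstrip (w : seq nat) : seq nat :=
  if w is a :: w' then
    if (w' == [::]) && (a == 0) then [::] else a :: rstrip w'
  else [::].

(** Replaces every maximal run of letters [>= k] by a slot, written [0]: this is a
letter that no permutation word contains.  The [lstrip] merges a new slot with the
slot that follows it, if any. *)
Definition contract k (w : seq nat) : seq nat :=
  foldr (fun a t => if a < k then a :: t else 0 :: lstrip t) [::] w.

Lemma lstripK w : nseq (head 1 w == 0) 0 ++ lstrip w = w.
Proof. by case: w => [|[|a] w]. Qed.

Lemma rstripK w : rstrip w ++ nseq (last 1 w == 0) 0 = w.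
Proof.
have K1 b v : rstrip (b :: v) ++ nseq (last b v == 0) 0 = b :: v.
  elim: v b => [|c v IH] [|b] //=; first by rewrite [in LHS]IH.
  by rewrite [in LHS]IH.
by case: w => [|b w] //; exact: K1.
Qed.

Lemma lstrip_nseq (e : bool) v : head 1 v != 0 -> lstrip (nseq e 0 ++ v) = v.
Proof. by case: e; case: v => [|[|b] v]. Qed.

Lemma rstrip_nseq (e : bool) u : last 1 u != 0 -> rstrip (u ++ nseq e 0) = u.
Proof.
move=> u0; have := rstripK (u ++ nseq e 0).
case: e => /=; rewrite ?cats0 ?last_cat /= ?(negbTE u0) /= ?cats0 // !cats1.
by move/rcons_inj => [].
Qed.

Lemma contract_cat_small k a u v : 0 < a < k ->
  contract k (u ++ a :: v) = contract k u ++ a :: contract k v.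
Proof.
move=> /andP[a0 ak]; elim: u => [|b u IH] /=; first by rewrite ak.
rewrite IH; case: ifP => // _; congr (_ :: _).
by case: (contract k u) => [|c t] /=; [case: a a0 {ak IH}|case: ifP].
Qed.

(** A letter [>= k] merges with the slots that touch it on either side. *)
Lemma contract_cat_big k a u v : k <= a -> 0 \notin u ->
  contract k (u ++ a :: v) = rstrip (contract k u) ++ 0 :: lstrip (contract k v).
Proof.
move=> ka; elim: u => [|b u IH] /=; first by rewrite ltnNge ka.
rewrite inE negb_or => /andP[b0 u0]; rewrite IH //; case: ifP => _ /=.
  by rewrite [b == 0]eq_sym (negbTE b0) andbF.
by case: (contract k u) => [|[|c] [|d t]].
Qed.

Lemma contractS k u : k \notin u -> contract k u = contract k.+1 u.
Proof.
elim: u => [|b u IH] //=; rewrite inE negb_or => /andP[bk /IH ->].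
by rewrite ltnS [b <= k]leq_eqVlt [b == k]eq_sym (negbTE bk).
Qed.

Lemma mem_contract k a w : a \in contract k w -> (a == 0) || (a \in w).
Proof.
elim: w => [|b w IH] //=; case: ifP => _; rewrite !inE.
  by case/orP => [->|/IH/orP[]->]; rewrite ?orbT.
case: (eqVneq a 0) => //= a0 aw; have : a \in contract k w.
  by move: aw; case: (contract k w) => [|[|c] t] //=; rewrite inE => ->; rewrite orbT.
by move/IH; rewrite (negbTE a0) /= => ->; rewrite orbT.
Qed.

Lemma contract_id k w : all (gtn k) w -> contract k w = w.
Proof. by elim: w => [|b w IH] //= /andP[-> /IH ->]. Qed.

Lemma contract1 (w : seq nat) : 0 \notin w -> w != [::] -> contract 1 w = [:: 0].
Proof.
elim: w => [|b w IH] //; rewrite inE negb_or => /andP[b0 w0] _ /=.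
rewrite ltnS leqn0 [b == 0]eq_sym (negbTE b0).
by case: w IH w0 => [|c w] // IH w0; rewrite IH.
Qed.

(** All the ways to single out one slot of [t], as the parts before and after it. *)
Fixpoint zsplits (t : seq nat) : seq (seq nat * seq nat) :=
  if t is a :: t' then
    (if a == 0 then [:: ([::], t')] else [::]) ++
    [seq (a :: uv.1, uv.2) | uv <- zsplits t']
  else [::].

Lemma mem_zsplits t uv : (uv \in zsplits t) = (t == uv.1 ++ 0 :: uv.2).
Proof.
elim: t uv => [|a t IH] [u v] /=; first by case: u.
rewrite mem_cat; case: u => [|b u] /=.
  rewrite eqseq_cons [X in _ || X]negbTE ?orbF; last by apply/mapP => -[[]].
  by case: eqP => _; rewrite ?inE // xpair_eqE /= eq_sym.
rewrite eqseq_cons [X in X || _]negbTE /=; last first.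
  by case: ifP; rewrite ?inE // xpair_eqE.
apply/mapP/andP => [[[u' v'] uv' [-> -> ->]]|[/eqP -> tuv]].
  by rewrite eqxx -(IH (u', v')).
by exists (u, v); rewrite // IH.
Qed.

Lemma uniq_zsplits t : uniq (zsplits t).
Proof.
elim: t => [|a t IH] //=; rewrite cat_uniq map_inj_uniq ?IH ?andbT; last first.
  by move=> [u v] [u' v'] [-> ->].
apply/andP; split; first by case: ifP.
by apply/hasPn => _ /mapP[[u v] _ ->]; case: ifP.
Qed.

Lemma eq_cat_cons (T : eqType) (a : T) s1 s2 s1' s2' :
  a \notin s1 -> a \notin s1' ->
  s1 ++ a :: s2 = s1' ++ a :: s2' -> s1 = s1' /\ s2 = s2'.
Proof.
elim: s1 s1' => [|b s1 IH] [|b' s1'] //=; rewrite ?inE ?negb_or.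
- by move=> _ _ [->].
- by move=> _ /andP[/eqP ab _] [/ab].
- by move=> /andP[/eqP ab _] _ [/esym/ab].
by move=> /andP[_ h] /andP[_ h'] [-> /(IH _ h h')[-> ->]].
Qed.

Definition no00 (a b : nat) := (a != 0) || (b != 0).

(** The words that can be contractions at level [k].  Starting the path at [1]
puts no constraint on the first letter. *)
Definition slot_word k t :=
  path no00 1 t && perm_eq [seq a <- t | a != 0] (iota 1 k.-1).

(** The chosen slot, between [uv.1] and [uv.2], receives [k]; [e] tells whether a
slot remains on the left and on the right of [k]. *)
Definition child k (uv : seq nat * seq nat) (e : bool * bool) : seq nat :=
  (uv.1 ++ nseq e.1 0) ++ k :: (nseq e.2 0 ++ uv.2).

Lemma slot_word_split k t uv : 0 < k -> slot_word k t -> uv \in zsplits t ->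
  [/\ last 1 uv.1 != 0, head 1 uv.2 != 0, k \notin uv.1 &
      forall e, slot_word k.+1 (child k uv e)].
Proof.
case: uv => u v k0 /andP[pt letters]; rewrite mem_zsplits /= => /eqP et.
move: pt letters; rewrite {t}et cat_path /= {2}/no00 orbF => /and3P[pu lu pv].
have hv : head 1 v != 0 by case: (v) pv => [|b v'] //= /andP[].
rewrite filter_cat /= => letters; split=> //.
  apply/negP => ku; have := perm_mem letters k.
  rewrite mem_cat mem_filter ku -lt0n k0 /= mem_iota add1n prednK // ltnn.
  by rewrite andbF.
move=> [e1 e2]; rewrite /slot_word /child /= -catA; apply/andP; split.
  rewrite cat_path pu /=; have k0' : k != 0 by rewrite -lt0n.
  have pk : path no00 k v.
    by case: (v) pv => [|b v'] //= /andP[_ ->]; rewrite /no00 k0'.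
  by case: e1; case: e2; rewrite /= /no00 ?k0' ?lu ?orbT //= ?pv ?pk.
have nseq0 (e : bool) : [seq a <- nseq e 0 | a != 0] = [::] by case: e.
rewrite !filter_cat /= -lt0n k0 !filter_cat !nseq0 /=.
have -> : iota 1 k.+1.-1 = rcons (iota 1 k.-1) k.
  by case: (k) k0 => // n _; have := iotaD 1 n 1; rewrite addn1 add1n cats1.
rewrite -cat1s perm_catCA perm_sym -cats1 perm_catC perm_sym.
by rewrite perm_cat2l.
Qed.

End Contraction.

(** * Words of permutations *)

Section WordsOfPermutations.

Local Open Scope nat_scope.

Section Letters.
Variables (N : nat) (s : 'S_N).

Lemma perm_word : perm_eq (word s) (iota 1 N).
Proof.
rewrite uniq_perm ?uniq_word ?iota_uniq // => a; rewrite mem_iota add1n ltnS.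
apply/mapP/idP => [[k _ ->]|/andP[a0 aN]]; first by rewrite /= ltn_ord.
have aN' : a.-1 < N by rewrite prednK.
exists ((s^-1)%g (Ordinal aN')); first by rewrite mem_enum.
by rewrite permKV /= prednK.
Qed.

Lemma mem_word a : (a \in word s) = (0 < a <= N).
Proof. by rewrite (perm_mem perm_word) mem_iota add1n ltnS. Qed.

Definition before j := take (index j (word s)) (word s).
Definition after j := drop (index j (word s)).+1 (word s).

Lemma word_split j : 0 < j <= N -> word s = before j ++ j :: after j.
Proof.
move=> jN; rewrite -[LHS](cat_take_drop (index j (word s))); congr (_ ++ _).
have jw : j \in word s by rewrite mem_word.
by rewrite (drop_nth 0) ?index_mem // nth_index.
Qed.

Lemma notin_before j : 0 < j <= N -> j \notin before j /\ j \notin after j.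
Proof.
move=> jN; have := uniq_word s; rewrite (word_split jN) uniq_catC /= mem_cat negb_or.
by case/andP => /andP[].
Qed.

End Letters.

Lemma word_inj N : injective (@word N).
Proof.
move=> s s' /eq_in_map e; apply/permP => i; apply/val_inj.
by have /(_ (mem_enum _ _)) [] := e i.
Qed.

Lemma word_surj N t : perm_eq t (iota 1 N) -> exists s : 'S_N, word s = t.
Proof.
move=> tN; have sz : size t = N by rewrite (perm_size tN) size_iota.
have tP (i : 'I_N) : 0 < nth 0 t i <= N.
  have : nth 0 t i \in t by rewrite mem_nth ?sz.
  by rewrite (perm_mem tN) mem_iota add1n ltnS.
have tlt (i : 'I_N) : (nth 0 t i).-1 < N.
  by have /andP[t0 tN'] := tP i; rewrite prednK.
have inj : injective (fun i => Ordinal (tlt i)).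
  move=> i j [] e; apply/val_inj/eqP => /=.
  rewrite -(nth_uniq 0 (s := t)) ?sz ?(perm_uniq tN) ?iota_uniq //.
  have /andP[ti _] := tP i; have /andP[tj _] := tP j.
  by rewrite -(prednK ti) e prednK.
exists (perm inj); apply: (@eq_from_nth _ 0) => [|i]; first by rewrite size_word sz.
rewrite size_word => iN.
rewrite (nth_map (Ordinal iN)) ?size_enum_ord // permE /= nth_enum_ord //.
by rewrite prednK; have /andP[] := tP (Ordinal iN).
Qed.

End WordsOfPermutations.

(** * Summing over permutations with a given contraction *)

Section FiberSum.

Variables (V : comNzRingType) (x h p q : V) (N : nat).

Definition slots (t : seq nat) : nat := count_mem 0%N t.

(** [c] counts the slots on the left and on the right of the chosen one, so that
the exponent of [h] is the number of slots after the choice, minus one; it is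
truncated to [0] when no slot remains, after the last letter. *)
Definition choice_weight (c : nat * nat) (e : bool * bool) : V :=
  p ^+ c.1 * q ^+ c.2 * x ^+ e.1 * h ^+ (c.1 + c.2 + e.1 + e.2)%N.-1.

(** The choice made for [j], read off the word: a slot remains on the left of [j]
exactly when the contraction of the part before [j] ends with a slot, and removing
that slot leaves the slots on the left of the chosen one. *)
Definition letter_weight (s : 'S_N) j : V :=
  let u := contract j.+1 (before s j) in
  let v := contract j.+1 (after s j) in
  choice_weight (slots (rstrip u), slots (lstrip v))
                (last 1%N u == 0%N, head 1%N v == 0%N).

Lemma slots_child k uv e : (0 < k)%N ->
  slots (child k uv e) = (slots uv.1 + slots uv.2 + e.1 + e.2)%N.
Proof.
move=> k0; rewrite /slots /child !count_cat /= !count_cat !count_nseq /=.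
by case: k k0 => // k _; rewrite !mul1n /= add0n; lia.
Qed.

Lemma sum_zsplits t :
  \sum_(uv <- zsplits t) p ^+ slots uv.1 * q ^+ slots uv.2 = pq_nat p q (slots t).
Proof.
elim: t => [|a t IH]; first by rewrite big_nil.
rewrite /= big_cat big_map /= /slots /=; case: eqP => _ /=.
  rewrite big_seq1 /= mul1r -IH big_distrr /=; congr (_ + _).
  by apply: eq_bigr => uv _; rewrite exprS mulrA.
by rewrite big_nil add0r add0n -IH.
Qed.

Lemma slots_zsplits t uv : uv \in zsplits t -> slots t = (slots uv.1 + slots uv.2)%N.+1.
Proof. by rewrite mem_zsplits => /eqP ->; rewrite /slots count_cat /= addnS. Qed.

(** The choice made for [k] is determined by the contraction at level [k + 1]. *)
Lemma child_contract k t uv e (s : 'S_N) :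
  (0 < k <= N)%N -> slot_word k t -> uv \in zsplits t ->
  (contract k.+1 (word s) == child k uv e) =
  (uv == (rstrip (contract k.+1 (before s k)), lstrip (contract k.+1 (after s k))))
  && (e == (last 1%N (contract k.+1 (before s k)) == 0%N,
            head 1%N (contract k.+1 (after s k)) == 0%N)).
Proof.
move=> kN tk uvt; have /andP[k0 _] := kN.
have [lu hv ku _] := slot_word_split k0 tk uvt.
rewrite (word_split s kN) contract_cat_small ?k0 //=.
have [kb _] := notin_before s kN.
case: uv e lu hv ku {uvt} => u v [e1 e2] /= lu hv ku.
set a := contract k.+1 (before s k); set b := contract k.+1 (after s k).
have ka : k \notin a.
  apply/negP => /mem_contract; rewrite (negbTE kb) orbF => /eqP k00.
  by rewrite k00 in k0.
have ku' : k \notin u ++ nseq e1 0%N.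
  rewrite mem_cat negb_or ku /=; case: e1 => //=.
  by rewrite inE -lt0n.
rewrite /child /= !xpair_eqE; apply/eqP/andP => [|[/andP[/eqP -> /eqP ->] /andP[/eqP -> /eqP ->]]]; last first.
  by rewrite rstripK lstripK.
move/(eq_cat_cons ka ku') => [-> ->].
rewrite rstrip_nseq // lstrip_nseq // !eqxx last_cat; split=> //.
by case: e1 {ku'}; case: e2; rewrite /= ?(negbTE lu) ?(negbTE hv).
Qed.

(** The contraction at level [k + 1] determines the one at level [k], by merging
[k] with the slots around it, so each fiber is a disjoint union of finer ones. *)
Lemma fiber_split k t (F : 'S_N -> V) : (0 < k <= N)%N -> slot_word k t ->
  \sum_(s | contract k (word s) == t) F s =
  \sum_(uv <- zsplits t) \sum_(e : bool * bool)
    \sum_(s | contract k.+1 (word s) == child k uv e) F s.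
Proof.
move=> kN tk.
under [RHS]eq_bigr => uv _.
  under eq_bigr => e _ do rewrite big_mkcond /=.
  rewrite exchange_big /=.
over.
rewrite exchange_big big_mkcond /=; apply: eq_bigr => s _.
have [kb ka] := notin_before s kN; have /andP[k0 kN'] := kN.
set uv0 := (rstrip (contract k.+1 (before s k)), lstrip (contract k.+1 (after s k))).
have -> : (contract k (word s) == t) = (uv0 \in zsplits t).
  rewrite mem_zsplits eq_sym (word_split s kN) contract_cat_big ?leqnn //.
    by rewrite (contractS kb) (contractS ka).
  apply/negP => b0; have : 0%N \in word s by rewrite (word_split s kN) mem_cat b0.
  by rewrite mem_word.
rewrite big_seq; under eq_bigr => uv uvt.
  under eq_bigr => e _ do rewrite (child_contract e s kN tk uvt).
over.
rewrite -big_seq /=; case: ifP => uv0t; last first.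
  rewrite big_seq big1 // => uv uvt; rewrite big1 // => e _.
  by case: eqP uvt => // ->; rewrite -/uv0 uv0t.
rewrite (bigD1_seq uv0) ?uniq_zsplits //= eqxx /= -big_mkcond big_pred1_eq.
by rewrite big1 ?addr0 // => uv /negbTE uvn; rewrite big1 // => e _; rewrite uvn.
Qed.

(** Only the number of slots matters: by [fiber_split] the fiber of [t] is the union
of the fibers of its children; on each of them the weight of [k] is constant, and
by induction the weight of the larger letters depends on the number of slots of
the child only. *)
Lemma fiber_sum r k t : (k + r = N.+1)%N -> (0 < k)%N -> slot_word k t ->
  \sum_(s | contract k (word s) == t) \prod_(k <= j < N.+1) letter_weight s j =
  hist x h p q r (slots t).
Proof.
elim: r k t => [|r IH] k t krN k0 tk.
  (* No letter is left: the fiber is a point if [t] has no slot, else empty. *)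
  have {krN} kN : k = N.+1 by lia.
  subst k; rewrite [RHS]/=.
  have cw (s : 'S_N) : contract N.+1 (word s) = word s.
    by apply/contract_id/allP => a; rewrite mem_word /= ltnS => /andP[].
  under eq_bigl => s do rewrite cw.
  under eq_bigr => s _ do rewrite big_geq //.
  have [t0|t0] := eqVneq (slots t) 0%N.
    have /andP[_] := tk; rewrite /= [filter _ _](all_filterP _); last first.
      have := has_count (pred1 0%N) t; rewrite -[count _ _]/(slots t) t0 ltnn.
      by move/negbT; rewrite -all_predC.
    move/word_surj => [s ts].
    rewrite (eq_bigl (pred1 s)) ?big_pred1_eq // => s' /=.
    by rewrite -ts (inj_eq (@word_inj N)).
  rewrite big1 // => s /eqP st.
  by case/negP: t0; rewrite -st /slots; apply/eqP/count_memPn; rewrite mem_word.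
have kN : (0 < k <= N)%N by lia.
rewrite (fiber_split _ kN tk) /=.
rewrite -sum_zsplits big_distrl big_seq [RHS]big_seq; apply: eq_bigr => uv uvt /=.
have [_ _ _ children] := slot_word_split k0 tk uvt.
transitivity (\sum_(e : bool * bool) choice_weight (slots uv.1, slots uv.2) e *
    hist x h p q r (slots uv.1 + slots uv.2 + e.1 + e.2)%N).
  apply: eq_bigr => e _; rewrite -(slots_child uv e k0) -(IH k.+1 (child k uv e)) //; last lia.
  rewrite big_distrr /=; apply: eq_bigr => s.
  rewrite (child_contract e s kN tk uvt) => /andP[/eqP uvE /eqP eE].
  rewrite big_ltn; last lia.
  by rewrite uvE eE.
pose G e := choice_weight (slots uv.1, slots uv.2) e *
  hist x h p q r (slots uv.1 + slots uv.2 + e.1 + e.2)%N.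
transitivity (\sum_(a : bool) \sum_(b : bool) G (a, b)).
  by rewrite pair_bigA; apply: eq_bigr => -[].
rewrite !big_bool {}/G /= (slots_zsplits uvt) /choice_weight /=.
rewrite !addn0 !addn1 /=; ring.
Qed.

End FiberSum.

Lemma sum_letter_weights (V : comNzRingType) (x h p q : V) n :
  \sum_(s : 'S_n.+1) \prod_(1 <= j < n.+2) letter_weight x h p q s j =
  hist x h p q n.+1 1.
Proof.
rewrite -(@fiber_sum _ x h p q n.+1 n.+1 1 [:: 0%N]) ?add1n //.
apply: eq_bigl => s; rewrite contract1 ?mem_word //.
by rewrite -size_eq0 size_word.
Qed.

(** * Reading the statistics off the contractions *)

Section Crossings.

Local Open Scope nat_scope.

Fixpoint crossings (r : rel nat) a (w : seq nat) : nat :=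
  if w is b :: w' then r a b + crossings r b w' else 0.

Definition enters k : rel nat := fun a b => a < k <= b.
Definition leaves k : rel nat := fun a b => b < k <= a.

Lemma slots_lstrip t : slots t = (head 1 t == 0) + slots (lstrip t).
Proof. by case: t => [|[|a] t]. Qed.

Lemma slots_rstrip t : slots t = slots (rstrip t) + (last 1 t == 0).
Proof.
by rewrite -[in LHS](rstripK t) /slots count_cat count_nseq /= mul1n.
Qed.

Lemma head_contract k a w : 0 < a -> (head 1 (contract k (a :: w)) == 0) = (k <= a).
Proof. by move=> a0 /=; case: ltnP => //= _; case: a a0. Qed.

Lemma last_contract k a w : 0 \notin a :: w ->
  (last 1 (contract k (a :: w)) == 0) = (k <= last a w).
Proof.
case/lastP: w => [|w b] w0.
  by rewrite /=; case: ltnP => // _; case: a w0.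
have /andP[b0 _] : (0 < b) && (0 \notin a :: w).
  by move: w0; rewrite -rcons_cons mem_rcons inE negb_or lt0n eq_sym.
rewrite last_rcons -rcons_cons -cats1; case: (ltnP b k) => [bk|kb].
  by rewrite contract_cat_small ?b0 // last_cat /=; case: b b0 {w0 bk}.
rewrite contract_cat_big //; first by rewrite last_cat.
by move: w0; rewrite -rcons_cons mem_rcons inE negb_or => /andP[].
Qed.

(** Every maximal run of letters [>= k] is entered once. *)
Lemma slots_contract k a w : 0 \notin a :: w ->
  slots (contract k (a :: w)) = (k <= a) + crossings (enters k) a w.
Proof.
elim: w a => [|b w IH] a; rewrite inE; last rewrite negb_or => /andP[a0 w0].
  move=> a0; rewrite /= [a < k]ltnNge; case: leqP => // _.
  by rewrite /slots /= [a == 0]eq_sym (negbTE a0).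
have b0 : 0 < b by move: w0; rewrite inE negb_or lt0n eq_sym => /andP[].
have := slots_lstrip (contract k (b :: w)); rewrite head_contract // IH //.
rewrite -[contract k [:: a, b & w]]/(if a < k then a :: contract k (b :: w)
  else 0 :: lstrip (contract k (b :: w))).
rewrite [crossings _ _ (b :: w)]/= /enters => e; case: ltnP => ak.
  rewrite /slots /= [a == 0]eq_sym (negbTE a0) -[count _ _]/(slots (contract k (b :: w))).
  by rewrite IH // add0n.
by rewrite -[slots (0 :: _)]/((slots (lstrip (contract k (b :: w)))).+1); lia.
Qed.

Lemma slots_lstrip_contract k a w : 0 \notin a :: w ->
  slots (lstrip (contract k (a :: w))) = crossings (enters k) a w.
Proof.
move=> w0; have := slots_lstrip (contract k (a :: w)).
rewrite slots_contract // head_contract; first by move/addnI.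
by move: w0; rewrite inE negb_or lt0n eq_sym => /andP[].
Qed.

(** A word that starts and ends below level [k] crosses it upwards as often as
downwards; the boundary terms correct for the other cases. *)
Lemma enters_leaves k a w :
  (k <= a) + crossings (enters k) a w = crossings (leaves k) a w + (k <= last a w).
Proof.
elim: w a => [|b w IH] a /=; first by rewrite addn0.
have := IH b; rewrite /enters /leaves.
by case: (leqP k a); case: (leqP k b) => /=; lia.
Qed.

Lemma slots_rstrip_contract k a w : 0 \notin a :: w ->
  slots (rstrip (contract k (a :: w))) = crossings (leaves k) a w.
Proof.
move=> w0; have := slots_rstrip (contract k (a :: w)).
by rewrite slots_contract // last_contract // enters_leaves => /addIn.
Qed.

Lemma crossings_map (r : rel nat) (l : nat -> nat) a m :
  crossings r (l a) [seq l i | i <- iota a.+1 m] =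
  \sum_(a <= i < a + m) r (l i) (l i.+1).
Proof.
elim: m a => [|m IH] a; first by rewrite addn0 big_geq.
by rewrite /= IH addSnnS [RHS]big_ltn // -addSnnS leq_addr.
Qed.

End Crossings.

Section Statistics.

Local Open Scope nat_scope.

Variables (N : nat) (s : 'S_N).
Let l := letter s.

Lemma word_letters : word s = [seq letter s i | i <- iota 1 N].
Proof.
apply: (@eq_from_nth _ 0); first by rewrite size_word size_map size_iota.
move=> i; rewrite size_word => iN.
by rewrite (nth_map 0) ?size_iota // nth_iota.
Qed.

Lemma sum_letters (G : nat -> nat) :
  \sum_(1 <= j < N.+1) G j = \sum_(1 <= i < N.+1) G (l i).
Proof.
rewrite /index_iota subSS subn0 -(perm_big _ (perm_word s)) /=.
by rewrite word_letters big_map.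
Qed.

Lemma before_letter i : 0 < i <= N ->
  before s (l i) = [seq l a | a <- iota 1 i.-1].
Proof.
case: i => // i /= iN; rewrite /before.
rewrite /l /letter /= index_uniq ?uniq_word ?size_word //.
by rewrite [in LHS]word_letters -map_take take_iota (minn_idPl _) // ltnW.
Qed.

Lemma after_letter i : 0 < i <= N ->
  after s (l i) = [seq l a | a <- iota i.+1 (N - i)].
Proof.
case: i => // i /= iN; rewrite /after.
rewrite /l /letter /= index_uniq ?uniq_word ?size_word //.
by rewrite [in LHS]word_letters -map_drop drop_iota add1n.
Qed.

Lemma zero_notin_letters a m : 0 < a -> a + m <= N.+1 ->
  0 \notin [seq l i | i <- iota a m].
Proof.
move=> a0 am; apply/mapP => -[i]; rewrite mem_iota => im li.
by have := @letter_gt0 _ s i; rewrite -/l -li => /(_ _); lia.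
Qed.

(** Each run of letters [>= k] that does not extend to the end of the part before
[l i] is left by one descent across [k]. *)
Lemma slots_before i k : 0 < i <= N ->
  slots (rstrip (contract k (before s (l i)))) =
  \sum_(1 <= a < i.-1) (l a.+1 < k <= l a).
Proof.
move=> iN; rewrite before_letter //; case: i iN => [|[|i]] // iN.
  by rewrite big_geq.
have := @zero_notin_letters 1 i.+1 isT; rewrite /= => w0.
rewrite slots_rstrip_contract; last by apply: w0; lia.
by rewrite (crossings_map _ l 1) add1n.
Qed.

Lemma slots_after i k : 0 < i <= N ->
  slots (lstrip (contract k (after s (l i)))) =
  \sum_(i.+1 <= b < N) (l b < k <= l b.+1).
Proof.
move=> iN; rewrite after_letter //.
case e: (N - i) => [|m]; first by rewrite big_geq //; lia.
have := @zero_notin_letters i.+1 m.+1 isT; rewrite /= => w0.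
rewrite slots_lstrip_contract; last by apply: w0; lia.
by rewrite (crossings_map _ l); congr (\sum_(_ <= b < _) _); lia.
Qed.

Lemma last_iota a m : last a (iota a.+1 m) = a + m.
Proof. by elim: m a => [|m IH] a /=; rewrite ?addn0 // IH addSnnS. Qed.

Lemma last_before i k : 0 < i <= N ->
  (last 1 (contract k (before s (l i))) == 0) = (1 < i) && (k <= l i.-1).
Proof.
move=> iN; rewrite before_letter //; case: i iN => [|[|i]] // iN.
have := @zero_notin_letters 1 i.+1 isT; rewrite /= => w0.
rewrite last_contract; last by apply: w0; lia.
rewrite (last_map l) /=; congr (_ <= l _).
by rewrite last_iota add1n.
Qed.

Lemma slots_word k : 0 < k ->
  slots (contract k (word s)) = \sum_(0 <= i < N) (l i < k <= l i.+1).
Proof.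
move=> k0; rewrite word_letters -(crossings_map (enters k) l 0).
have := @zero_notin_letters 1 N isT (leqnn _); rewrite -/l.
case: [seq l i | i <- iota 1 N] => [|a w] // w0.
by rewrite slots_contract //= /enters k0.
Qed.

Lemma sum_last_before :
  \sum_(1 <= j < N.+1) (last 1 (contract j.+1 (before s j)) == 0) = des s.
Proof.
rewrite sum_letters /des -sum1_card [RHS]big_mkcond /=.
rewrite (eq_bigr (fun i : 'I_N => ((0 < i) && (l i > l i.+1) : nat))); last first.
  by move=> i _; rewrite inE; case: ifP.
rewrite -(big_mkord predT (fun i => ((0 < i) && (l i > l i.+1) : nat))).
rewrite big_add1 /=; apply: eq_big_nat => i /andP[_ iN].
by rewrite last_before.
Qed.

(** For the letter at position [i], the descent from position [i - 1] is outside the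
sum in [slots_before]; it is no pattern either, since its lower letter would be the
2 itself. *)
Lemma sum_slots_before :
  \sum_(1 <= j < N.+1) slots (rstrip (contract j.+1 (before s j))) = pat31_2 s.
Proof.
rewrite sum_letters /pat31_2 -sum1_card [RHS]big_mkcond /=.
transitivity (\sum_(b < N.+1) \sum_(a < N.+1)
  ([&& 1 <= a, a < b, l a > l b & l b > l a.+1] : nat)); last first.
  rewrite exchange_big pair_bigA; apply: eq_bigr => -[a b] _.
  by rewrite inE /=; case: ifP.
rewrite -(big_mkord predT (fun b => \sum_(a < N.+1)
  [&& 1 <= a, a < b, l a > l b & l b > l a.+1])).
rewrite [RHS]big_ltn // [X in X + _]big1 ?add0n; last first.
  by move=> a _; rewrite ltn0 andbF.
apply: eq_big_nat => i iN; rewrite slots_before //.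
rewrite -(big_mkord predT (fun a => [&& 1 <= a, a < i, l a > l i & l i > l a.+1] : nat)).
rewrite [RHS]big_ltn // add0n [RHS](big_cat_nat (n := i)) /=; try lia.
rewrite [X in _ + X]big_nat_cond [X in _ + X]big1 ?addn0; last first.
  move=> a /andP[ai _]; have -> : (a < i) = false by lia.
  by rewrite andbF.
case: i iN => // -[|i] iN; first by rewrite !big_geq.
rewrite [RHS]big_nat_recr //= ltnn !andbF addn0.
apply: eq_big_nat => a ai; rewrite !ltnS.
have -> : (0 < a) by lia.
have -> : (a <= i.+1) by lia.
have /negbTE : l a.+1 != l i.+2.
  by apply/eqP => /letter_inj; lia.
by rewrite andbC [l a.+1 <= _]leq_eqVlt => ->.
Qed.

Lemma sum_slots_after :
  \sum_(1 <= j < N.+1) slots (lstrip (contract j.+1 (after s j))) = pat2_13 s.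
Proof.
rewrite sum_letters /pat2_13 -sum1_card [RHS]big_mkcond /=.
transitivity (\sum_(a < N.+1) \sum_(b < N.+1)
  [&& 1 <= a, a < b, b < N, l b < l a & l a < l b.+1]); last first.
  rewrite pair_bigA; apply: eq_bigr => -[a b] _.
  by rewrite inE /=; case: ifP.
rewrite -(big_mkord predT (fun a => \sum_(b < N.+1)
  [&& 1 <= a, a < b, b < N, l b < l a & l a < l b.+1])).
rewrite [RHS]big_ltn // [X in X + _]big1 ?add0n; last by [].
apply: eq_big_nat => i iN; rewrite slots_after //.
rewrite -(big_mkord predT (fun b => [&& 1 <= i, i < b, b < N, l b < l i & l i < l b.+1] : nat)).
rewrite [RHS](big_cat_nat (n := i.+1)) /=; try lia.
rewrite [X in X + _]big_nat_cond [X in X + _]big1 ?add0n; last first.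
  move=> b /andP[bi _]; have -> : (i < b) = false by lia.
  by rewrite andbF.
have [->|iN'] := eqVneq i N; first by rewrite !big_geq.
rewrite [RHS]big_nat_recr /=; last lia.
rewrite ltnn !andbF addn0.
apply: eq_big_nat => b bi; rewrite !ltnS.
have -> : (0 < i) by lia.
have -> : (i < b) by lia.
have -> : (b < N) by lia.
have /negbTE : l b != l i.
  by apply/eqP => /letter_inj; lia.
by rewrite [l b <= _]leq_eqVlt => ->.
Qed.

End Statistics.

(** * The statistic [D] as an area *)

Section AreaStatistic.

Local Open Scope nat_scope.

Variables (N : nat) (s : 'S_N).
Hypothesis N0 : 0 < N.
Let l := letter s.

Lemma letter_le i : l i <= N.
Proof.
case: i => [|i]; first by rewrite /l /letter.
rewrite /l /letter /=; have [iN|Ni] := ltnP i N; last by rewrite nth_default ?size_word.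
by have := mem_nth 0 (s := word s); rewrite size_word => /(_ i iN); rewrite mem_word => /andP[].
Qed.

Lemma sum_between n a b : \sum_(1 <= k < n.+1) (a < k <= b) = minn n b - a.
Proof.
elim: n => [|n IH]; first by rewrite big_geq // min0n.
by rewrite big_nat_recr //= IH; lia.
Qed.

(** Each ascent starts one run at every level that it crosses. *)
Lemma sum_slots_word :
  \sum_(1 <= k < N.+1) slots (contract k (word s)) = \sum_(0 <= i < N) (l i.+1 - l i).
Proof.
rewrite big_nat; under eq_bigr => k /andP[k0 _] do rewrite slots_word //.
rewrite -big_nat exchange_big /=; apply: eq_bigr => i _.
by rewrite sum_between (minn_idPr _) // letter_le.
Qed.

(** By [sum_slots_word] the slots at the levels 1, .., [N] amount to the total ascent.
Shifting the levels by one drops the single slot at level 1, and the truncated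
subtraction removes one slot at each of the levels 2, .., [N]. *)
Lemma sum_heights :
  \sum_(1 <= j < N.+1) (slots (contract j.+1 (word s))).-1 + N =
  \sum_(0 <= i < N) (l i.+1 - l i).
Proof.
rewrite -sum_slots_word big_nat_recr //= contract_id; last first.
  by apply/allP => a; rewrite mem_word /= ltnS => /andP[].
have -> : slots (word s) = 0 by apply/count_memPn; rewrite mem_word.
rewrite addn0 [RHS]big_ltn // contract1 ?mem_word //; last first.
  by rewrite -size_eq0 size_word -lt0n.
rewrite [in RHS]big_add1 /=.
suff -> : \sum_(1 <= j < N) slots (contract j.+1 (word s)) =
    \sum_(1 <= j < N) (slots (contract j.+1 (word s))).-1 + \sum_(1 <= j < N) 1.
  by rewrite sum_nat_const_nat; lia.
rewrite -big_split /=; apply: eq_big_nat => j jN; rewrite addn1 prednK //.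
rewrite (word_split s (j := N)) ?N0 ?leqnn //.
rewrite contract_cat_big; [|by lia|].
  by rewrite /slots count_cat /= addnS.
apply/negP => b0; have : 0 \in word s.
  by rewrite (word_split s (j := N)) ?N0 ?leqnn // mem_cat b0.
by rewrite mem_word.
Qed.

Lemma max_is_peak : N \in Pk s.
Proof.
have [i iN li] := letter_surj s N0; apply/mapP; exists i; last by [].
rewrite mem_filter mem_iota add1n ltnS iN andbT /is_peak li.
have h1 := @letter_neqS _ s i.-1 N0; have h2 := @letter_neqS _ s i N0.
have := letter_le i.-1; have := letter_le i.+1; rewrite /l.
by move: h1 h2; rewrite (prednK (proj1 (andP iN))) li; lia.
Qed.

Local Open Scope ring_scope.

(** Peaks minus valleys is the total ascent of the word, by summation by parts:
[l i] is counted when an ascent ends at [i] and discounted when one starts there.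
The term [N] restores the largest letter, always a peak, which [D] omits. *)
Lemma D_ascents :
  D s + N%:Z = (\sum_(0 <= i < N) (l i.+1 - l i))%N%:Z.
Proof.
pose asc i : int := (l i < l i.+1)%N%:R.
have -> : D s + N%:Z = \sum_(1 <= i < N.+1) (asc i.-1 - asc i) * (l i)%:Z.
  transitivity (\sum_(i <- Pk s) i%:Z - \sum_(j <- Val s) j%:Z : int).
    by rewrite (bigD1_seq N max_is_peak (uniq_Pk s)) /= /D; ring.
  rewrite /Pk /Val !big_map !big_filter.
  rewrite [X in X - _]big_mkcond [X in _ - X]big_mkcond /= -sumrB.
  have -> : iota 1 N = index_iota 1 N.+1 by rewrite /index_iota subn1.
  apply: eq_big_nat => i iN.
  have h1 : l i.-1 != l i.
    have := @letter_neqS _ s i.-1 N0.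
    by rewrite (prednK (proj1 (andP iN))); apply; lia.
  have h2 : l i != l i.+1 by apply: letter_neqS => //; lia.
  rewrite /is_peak /is_valley /asc -/l (prednK (proj1 (andP iN))); move: h1 h2.
  by case: (ltngtP (l i.-1) (l i)) => // _ _;
    case: (ltngtP (l i) (l i.+1)) => // _ _ /=; ring.
under [LHS]eq_bigr => i _ do rewrite mulrBl.
rewrite sumrB [X in X - _]big_add1 /=.
have -> : \sum_(1 <= i < N.+1) asc i * (l i)%:Z = \sum_(0 <= i < N) asc i * (l i)%:Z.
  transitivity (\sum_(0 <= i < N.+1) asc i * (l i)%:Z).
    by rewrite [RHS]big_ltn // [l 0]/= mulr0 add0r.
  by rewrite big_nat_recr //= {2}/asc [l N.+1]letter_last ltn0 mul0r addr0.
rewrite -sumrB -natz natr_sum; apply: eq_bigr => i _; rewrite natz /asc.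
by case: ltnP => ll; rewrite /= ?mulr1n ?mulr0n; lia.
Qed.

End AreaStatistic.

(** * Hankel total positivity *)

Lemma slots_split N (s : 'S_N) j : (0 < j <= N)%N ->
  slots (contract j.+1 (word s)) =
  (slots (rstrip (contract j.+1 (before s j))) +
   slots (lstrip (contract j.+1 (after s j))) +
   (last 1 (contract j.+1 (before s j)) == 0) +
   (head 1 (contract j.+1 (after s j)) == 0))%N.
Proof.
move=> jN; have /andP[j0 _] := jN.
rewrite (word_split s jN) contract_cat_small ?j0 //=.
rewrite [LHS]/slots count_cat /= [j == 0%N]gtn_eqF // -!/(slots _).
rewrite (slots_rstrip (contract _ (before s j))).
by rewrite (slots_lstrip (contract _ (after s j))); lia.
Qed.

Lemma prod_letter_weight (V : comNzRingType) (x h p q : V) N (s : 'S_N) :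
  (0 < N)%N ->
  \prod_(1 <= j < N.+1) letter_weight x h p q s j =
  x ^+ des s * h ^+ `|D s|%N * p ^+ pat31_2 s * q ^+ pat2_13 s.
Proof.
move=> N0.
have -> : `|D s|%N = \sum_(1 <= j < N.+1) (slots (contract j.+1 (word s))).-1.
  by have := D_ascents s N0; rewrite -(sum_heights s N0) PoszD => /addIr ->.
rewrite -sum_last_before -sum_slots_before -sum_slots_after -!prodrXr -!big_split /=.
apply: eq_big_nat => j jN.
rewrite slots_split // /letter_weight /choice_weight /=; ring.
Qed.

Lemma A_hist (V : comNzRingType) (x h p q : V) n :
  A x h p q n = hist x h p q n.+1 1.
Proof.
rewrite -sum_letter_weights /A; apply: eq_bigr => s _.
by rewrite prod_letter_weight.
Qed.

Section NonnegativePolynomials.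

Variables (R : realFieldType) (d : nat).

Definition nonneg_mpoly : {pred {mpoly R[d]}} :=
  fun P => P \is a mpolyOver d Num.nneg.

Lemma coef_nonnegP P : reflect (coef_nonneg P) (P \in nonneg_mpoly).
Proof. exact: (iffP (mpolyOverP _)). Qed.

Fact nonneg_mpoly_closed : semiring_closed nonneg_mpoly.
Proof. by split; [exact: mpolyOver_addr_closed|exact: mpolyOver_mulr_closed]. Qed.

HB.instance Definition _ :=
  GRing.isSemiringClosed.Build {mpoly R[d]} nonneg_mpoly nonneg_mpoly_closed.

Lemma mpolyX_nonneg i : 'X_i \in nonneg_mpoly.
Proof. exact: mpolyOverX. Qed.

End NonnegativePolynomials.

Theorem theorem7p7 (R : realFieldType) :
  coefficientwise_Hankel_TP (A ('X_0 : {mpoly R[4]}) 'X_1 'X_2 'X_3).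
Proof.
move=> k I J Ii Ji; apply/coef_nonnegP.
(* All the exponents [I i + J j] are at most [m], so that the truncation is exact. *)
pose m := (\max_i I i + \max_j J j)%N.
have IJm i j : (I i + J j <= m)%N by rewrite leq_add ?leq_bigmax.
rewrite /minor.
have -> : \matrix_(i < k, j < k) hankel (A 'X_0 'X_1 'X_2 'X_3) (I i) (J j) =
    \matrix_(i < k, j < k)
      (motzkin_mx ('X_0 : {mpoly R[4]}) 'X_1 'X_2 'X_3 m ^+ (I i + J j)) ord0 ord0.
  apply/matrixP => i j; rewrite !mxE /hankel A_hist.
  by rewrite (@hist_motzkin _ _ _ _ _ m _ 0 (ltn0Sn m)) ?add0n.
apply: (hankel_corner_minor (S := @nonneg_mpoly R 4)) => //.
by apply: motzkin_TP; exact: mpolyX_nonneg.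
Qed.
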